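(* Let $G,H$ be graphs and let $k$ be a positive integer. The following statements hold. \begin{enumerate} \item If $|V(H)| \geq k$, then $b_k(G\,\square\, H) \geq \mathrm{CL}(G)$. \item If $|V(H)| \geq \mathrm{diam}(G)+k$, then $b_k(G\,\square\, H) \geq \mathrm{diam}(G)+1$. \end{enumerate}
   Context: All graphs are finite, simple and undirected. $\mathrm{diam}(G)$ is the maximum distance between two vertices of $G$ (infinite if $G$ is disconnected), and $\square$ is the Cartesian product: $(u,v)$ and $(x,y)$ are adjacent iff $u=x$ and $vy$ is an edge, or $v=y$ and $ux$ is an edge. Cooling number: initially all vertices of $G$ are uncooled. In each round, first every uncooled vertex with a cooled neighbor becomes cooled, then one uncooled vertex (if any remains) is chosen and cooled. $\mathrm{CL}(G)$ is the maximum, over all choices, of the number of rounds until all vertices are cooled (the round in which the last vertex becomes cooled is counted). $k$-liminal burning game on $G$ ($k$ a positive integer): two players, Saboteur and Arsonist. Each vertex is burned or unburned, and revealed or unrevealed; initially all are unburned and unrevealed. In each round: (i) propagation: every unburned vertex with a neighbor burned in an earlier round becomes burned (whether revealed or not); (ii) the Saboteur reveals $k$ vertices that are unrevealed and unburned (all such vertices if fewer than $k$ exist); revealed vertices stay revealed; (iii) the Arsonist burns one revealed unburned vertex (revealed in this or any earlier round), if one exists. The game ends in the round in which all vertices are burned. The Saboteur maximizes and the Arsonist minimizes the number of rounds; $b_k(G)$ is the number of rounds under optimal play. *)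

(* Defs.v *)
From mathcomp Require Import all_boot.

Set Implicit Arguments.
Unset Strict Implicit.
Unset Printing Implicit Defensive.

Record sgraph := SGraph {
  vertex :> finType;
  edge : rel vertex;
  edge_sym : symmetric edge;
  edge_irr : irreflexive edge }.

Section Cartesian.
Variables G H : sgraph.

Definition cart_edge : rel (G * H) := fun a b =>
  ((a.1 == b.1) && edge a.2 b.2) || ((a.2 == b.2) && edge a.1 b.1).

Lemma cart_edge_sym : symmetric cart_edge.
Proof.
move=> a b; rewrite /cart_edge (eq_sym a.1) (eq_sym a.2).
by rewrite (edge_sym a.1) (edge_sym a.2).
Qed.

Lemma cart_edge_irr : irreflexive cart_edge.
Proof. by move=> a; rewrite /cart_edge !edge_irr !andbF. Qed.

Definition cartesian : sgraph := SGraph cart_edge_sym cart_edge_irr.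
End Cartesian.

Notation "G □ H" := (cartesian G H) (at level 40, left associativity).

Section Distance.
Variable G : sgraph.

(* A shortest walk has fewer than #|G| edges, so the search succeeds whenever
   x and y are connected; otherwise it returns the junk value #|G|. *)
Definition dist (x y : G) : nat :=
  find (fun n => [exists p : n.-tuple G, path (@edge G) x p && (last x p == y)])
       (iota 0 #|G|).

(* None stands for an infinite diameter. *)
Definition diam : option nat :=
  if [forall x : G, forall y : G, connect (@edge G) x y]
  then Some (\max_(x : G) \max_(y : G) dist x y) else None.
End Distance.

Section Processes.
Variable G : sgraph.
Implicit Types A B C R S : {set G}.

Definition spread B : {set G} :=
  B :|: [set y | [exists x in B, edge x y]].

(* The possible outcomes of adding to B one vertex of A, if there is one. *)
Definition add_one A B : {set {set G}} :=
  if A == set0 then [set B] else [set v |: B | v in A].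

(* The maximum number of rounds until everything is cooled, when C is cooled
   now, with the count cut off at n.  Every round cools a new vertex, so the
   cutoff n = #|G| is never active. *)
Fixpoint cooling_rounds (n : nat) C : nat :=
  if C == setT then 0 else
  if n is m.+1 then
    (\max_(C' in add_one (~: spread C) (spread C)) cooling_rounds m C').+1
  else 0.

Definition cooling_number : nat := cooling_rounds #|G| set0.

(* B' is the set of vertices burned after the propagation of the round. *)
Definition reveal_moves (k : nat) B' R : {set {set G}} :=
  let U := ~: (B' :|: R) in
  [set S : {set G} | (S \subset U) && (#|S| == minn k #|U|)].

(* The minimax number of remaining rounds when B is burned and R is revealed,
   with the count cut off at n.  The value with cutoff m is at most m, so the
   default m of minn is neutral (add_one is never empty).  If 0 < k, every
   round burns a new vertex: a vertex left unburned by the propagation is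
   either revealed already or forces the Saboteur to reveal some unburned
   vertex.  Hence the cutoff n = #|G| is never active. *)
Fixpoint burning_rounds (k n : nat) B R : nat :=
  if B == setT then 0 else
  if n is m.+1 then
    (\max_(S in reveal_moves k (spread B) R)
       \big[minn/m]_(B' in add_one ((R :|: S) :\: spread B) (spread B))
          burning_rounds k m B' (R :|: S)).+1
  else 0.

Definition liminal_number (k : nat) : nat :=
  burning_rounds k #|G| set0 set0.
End Processes.

(* Main.v *)
Require Import Defs.
From mathcomp Require Import all_boot.

Set Implicit Arguments.
Unset Strict Implicit.
Unset Printing Implicit Defensive.

(** Both bounds come from Saboteur strategies on [G □ H] that reveal, in each
    round, [k] vertices of a single copy [{w} × H] of [H].  For the first bound,
    [w] is the vertex cooled in an optimal play of the cooling process on [G]: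
    the projection to [G] of the burned and revealed vertices stays inside the
    cooled set.  For the second, let [u] be an endpoint of a diametral path and
    in round [t + 1] take [w] at distance [t] from [u].  Fire then never runs
    ahead of distance [t], and the vertices burned at distance exactly [t] have
    at most [t + 1] distinct [H]-coordinates, since one round only shifts the
    old coordinates outwards and adds one new coordinate; hence [{w} × H]
    always retains [k] vertices to reveal. *)

Section Moves.
Variable G : sgraph.
Implicit Types A B R S : {set G}.

Lemma spreadP B y :
  reflect (y \in B \/ exists2 x, x \in B & edge x y) (y \in spread B).
Proof.
rewrite !inE; apply: (iffP orP) => -[yB|]; try by left.
  by case/exists_inP=> x xB xy; right; exists x.
by case=> x xB xy; right; apply/exists_inP; exists x.
Qed.

Lemma add_one_inv A B B' :
  B' \in add_one A B -> {subset B' <= B} \/ exists2 v, v \in A & B' = v |: B.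
Proof.
rewrite /add_one; case: eqP => _; first by rewrite inE => /eqP->; left.
by case/imsetP=> v vA ->; right; exists v.
Qed.

Lemma cooling_rounds_le n B : cooling_rounds n B <= n.
Proof.
elim: n B => [|n IH] B /=; case: eqP => // _.
by rewrite ltnS; apply/bigmax_leqP.
Qed.

(** One Saboteur move [S] bounds the outer maximum from below; [c <= m] covers the default value [m]
    of the inner minimum. *)
Lemma burning_rounds_move k m c B R S :
  B != setT -> S \subset ~: (spread B :|: R) -> #|S| = k -> c <= m ->
  (forall B', B' \in add_one ((R :|: S) :\: spread B) (spread B) ->
     c <= burning_rounds k m B' (R :|: S)) ->
  c < burning_rounds k m.+1 B R.
Proof.
move=> /negPf /= -> sSU cS cm cB; rewrite ltnS.
have Sin : S \in reveal_moves k (spread B) R.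
  by rewrite inE sSU cS eq_sym; apply/eqP/minn_idPl; rewrite -cS subset_leq_card.
apply: (leq_trans _ (leq_bigmax_cond _ Sin)).
by elim/big_ind: _ => // x y; rewrite leq_min => -> ->.
Qed.

Lemma dist_refl (x : G) : dist x x = 0.
Proof.
rewrite /dist; have : 0 < #|G| by apply/card_gt0P; exists x.
case: #|G| => //= n _; case: existsP => // -[].
by exists [tuple]; rewrite /= eqxx.
Qed.

(** Append [z] to a shortest walk from [x] to [y]. If the new length falls outside the search range,
    the cap [#|G|] on [dist x z] already gives the bound. *)
Lemma dist_edge (x y z : G) : edge y z -> dist x z <= (dist x y).+1.
Proof.
move=> yz; pose a v n := [exists p : n.-tuple G, path (@edge G) x p && (last x p == v)].
change (find (a z) (iota 0 #|G|) <= (find (a y) (iota 0 #|G|)).+1).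
have az_size : find (a z) (iota 0 #|G|) <= #|G|.
  by rewrite -{2}(size_iota 0 #|G|) find_size.
case: (ltnP (find (a y) (iota 0 #|G|)).+1 #|G|) => [lt_n|]; last exact: leq_trans.
have has_y : has (a y) (iota 0 #|G|) by rewrite has_find size_iota ltnW.
have := nth_find 0 has_y; rewrite nth_iota ?add0n ?(ltnW lt_n) //.
set n := find _ _ in lt_n * => /existsP[p /andP[xp /eqP lp]].
rewrite leqNgt; apply/negP => /(before_find 0).
rewrite nth_iota ?add0n //; case/existsP.
by exists [tuple of rcons p z]; rewrite rcons_path xp lp yz last_rcons eqxx.
Qed.

(** A discrete intermediate value argument: [l] climbs by at most one per edge. *)
Lemma path_layers (l : G -> nat) x p t :
  (forall y z, edge y z -> l z <= (l y).+1) ->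
  path (@edge G) x p -> l x <= t <= l (last x p) -> exists w, l w = t.
Proof.
move=> l_edge; elim: p x => [|y p IH] x /=.
  by move=> _ t_lx; exists x; apply/eqP; rewrite eqn_leq.
case/andP=> xy yp /andP[]; rewrite leq_eqVlt => /orP[/eqP<- _|lt_xt le_t].
  by exists x.
by apply: (IH y) => //; rewrite le_t (leq_trans (l_edge _ _ xy)).
Qed.

(** Take for [l] the distance from one end of a diametral pair; the game argument uses only these
    two properties of it. *)
Lemma diam_layers d : 0 < #|G| -> diam G = Some d ->
  exists l : G -> nat, (forall y z, edge y z -> l z <= (l y).+1) /\
    (forall t, t <= d -> exists w, l w = t).
Proof.
move=> G_gt0; rewrite /diam; case: forallP => // conG [<-].
have [x ->] := eq_bigmax (fun x : G => \max_(y : G) dist x y) G_gt0.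
have [y ->] := eq_bigmax (dist x) G_gt0.
exists (dist x); split=> [u v|t le_t]; first exact: dist_edge.
have /connectP[p xp ey] := forallP (conG x) y.
by apply: (path_layers _ xp); [exact: dist_edge | rewrite dist_refl -ey].
Qed.

End Moves.

Section Product.
Variables G H : sgraph.

Lemma column_subset k (w : G) (D : {set H}) : k <= #|D| ->
  exists2 S : {set G □ H}, #|S| = k &
    forall v, v \in S -> v.1 = w /\ v.2 \in D.
Proof.
case/card_geqP=> s [s_uniq <- sD].
exists [set (w, h) | h in s] => [|_ /imsetP[h hs ->]]; last by split=> //; apply: sD.
by rewrite card_imset ?(card_uniqP s_uniq) // => h h' [].
Qed.

Lemma spread_cartesian (B : {set G □ H}) v : v \in spread B ->
  exists2 b, b \in B & v.1 = b.1 \/ edge b.1 v.1 /\ v.2 = b.2.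
Proof.
case/spreadP=> [vB|[b bB]]; first by exists v => //; left.
case/orP=> /andP[/eqP e uv]; exists b => //; first by left.
by right.
Qed.

Lemma cooling_le_burning k n m (C : {set G}) (B R : {set G □ H}) :
  0 < k <= #|H| -> n <= m ->
  (forall v, v \in B -> v.1 \in C) -> (forall v, v \in R -> v.1 \in C) ->
  cooling_rounds n C <= burning_rounds k m B R.
Proof.
case/andP=> k_gt0 kH; have /card_gt0P[h0 _] := leq_trans k_gt0 kH.
elim: n m C B R => [|n IH] [|m] C B R //; first by move=> *; rewrite /=; case: eqP.
  by move=> *; rewrite [X in X <= _]/=; case: eqP.
rewrite ltnS => le_nm BC RC.
have [CT|CT] := eqVneq C setT; first by rewrite /= CT eqxx.
have BT : B != setT.
  apply: contraNneq CT => BT; apply/eqP/setP=> x; rewrite inE.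
  by apply: (BC (x, h0)); rewrite BT inE.
have sBC v : v \in spread B -> v.1 \in spread C.
  case/spread_cartesian=> b /BC bC [->|[bv _]]; apply/spreadP; first by left.
  by right; exists b.1.
have sRC v : v \in R -> v.1 \in spread C by move/RC=> vC; apply/spreadP; left.
(* Naming the value [r.+1] lets the left side unfold and its successor cancel while the burning side
   stays folded. *)
case Er: (burning_rounds k m.+1 B R) => [|r]; first by move: Er; rewrite /= (negPf BT).
rewrite /= (negPf CT) ltnS; apply/bigmax_leqP=> C' C'in; rewrite -ltnS -Er.
(* If propagation alone cools [G], no cooling rounds remain after this one, and the burning game
   also lasts at least one round since [B] is not full. *)
have [v0|[w w_out]] := set_0Vmem (~: spread C).
  move: C'in; rewrite /add_one v0 eqxx inE => /eqP->.
  have -> : spread C = setT by rewrite -[spread C]setCK v0 setC0.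
  by case: (n) => [|n']; rewrite /= eqxx /= (negPf BT).
have : ~: spread C != set0 by apply/set0Pn; exists w.
move: C'in; rewrite /add_one; case: eqP => // _ /imsetP[{w_out}w w_out ->] _.
rewrite inE in w_out.
have [|S cS Sw] := @column_subset k w [set: H]; first by rewrite cardsT.
have S_out v : v \in S -> v.1 \notin spread C by case/Sw=> ->.
apply: (@burning_rounds_move _ k m _ B R S) => //.
- apply/subsetP=> v vS; rewrite inE in_setU negb_or; apply/andP; split.
    by apply: contra (S_out v vS) => /sBC.
  by apply: contra (S_out v vS) => /sRC.
- exact: leq_trans (cooling_rounds_le _ _) le_nm.
have RSC v : v \in R :|: S -> v.1 \in w |: spread C.
  rewrite in_setU1 => /setUP[/sRC->|/Sw[-> _]]; last by rewrite eqxx.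
  by rewrite orbT.
move=> B' /add_one_inv B'in; apply: IH => // v.
case: B'in => [B'B /B'B /sBC vC|[v' /setDP[/RSC v'C _] ->]].
  by rewrite in_setU1 vC orbT.
by case/setU1P=> [->//|/sBC vC]; rewrite in_setU1 vC orbT.
Qed.

(** After [t] rounds, [A] contains the [H]-coordinates of the fire in the outermost layer [t - 1].
    Writing this layer as [(l v.1).+1 = t] makes the condition vacuous at [t = 0]. *)
Lemma layers_le_burning k d (l : G -> nat) t m (A : {set H}) (B R : {set G □ H}) :
  0 < k -> d + k <= #|H| ->
  (forall y z, edge y z -> l z <= (l y).+1) ->
  (forall t, t <= d -> exists w, l w = t) ->
  d.+1 - t <= m -> #|A| <= t ->
  (forall v, v \in B -> l v.1 < t) -> (forall v, v \in R -> l v.1 < t) ->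
  (forall v, v \in B -> (l v.1).+1 = t -> v.2 \in A) ->
  d.+1 - t <= burning_rounds k m B R.
Proof.
move=> k_gt0 dkH l_edge l_onto; elim: m t A B R => [|m IH] t A B R.
  by rewrite leqn0 => /eqP->.
case: (ltnP d t) => [|le_td]; first by rewrite -subn_eq0 => /eqP->.
rewrite subSn // ltnS => le_m cA Bt Rt BA.
have BT : B != setT.
  have [w lw] := l_onto d (leqnn d).
  have /card_gt0P[h _] : 0 < #|H| by apply: leq_trans dkH; rewrite addn_gt0 k_gt0 orbT.
  apply: contraTneq le_td => BT; rewrite -ltnNge -lw.
  by apply: (Bt (w, h)); rewrite BT inE.
have [w lw] := l_onto t le_td.
have kA : k <= #|~: A|.
  rewrite -(leq_add2l #|A|) cardsC; apply: leq_trans dkH; rewrite leq_add2r.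
  exact: leq_trans le_td.
have [S cS Sw] := column_subset w kA.
(* Propagation enters layer [t] only along [G]-edges from layer [t - 1], and these keep the
   [H]-coordinate. *)
have sB v : v \in spread B -> l v.1 <= t /\ (l v.1 = t -> v.2 \in A).
  case/spread_cartesian=> b bB [->|[bv ->]].
    by split=> [|lb]; [exact: ltnW (Bt b bB) | have := Bt b bB; rewrite lb ltnn].
  have lv := l_edge _ _ bv; split; first exact: leq_trans lv (Bt b bB).
  by move=> lvt; apply: BA => //; apply/eqP; rewrite eqn_leq Bt // -lvt lv.
apply: (@burning_rounds_move _ k m _ B R S) => //.
  apply/subsetP=> v /Sw[v1 v2]; rewrite inE in_setU negb_or; apply/andP; split.
    by apply: contraL v2 => /sB[_ vA]; rewrite inE negbK vA // v1.
  by apply/negP=> /Rt; rewrite v1 lw ltnn.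
have RSt v : v \in R :|: S -> l v.1 <= t.
  by case/setUP=> [/Rt/ltnW//|/Sw[-> _]]; rewrite lw.
rewrite -subSS in le_m *.
move=> B' /add_one_inv[B'B|[b /setDP[/RSt bt _] ->]].
  apply: (IH _ A) => // [|v /B'B/sB[]|v /B'B/sB[_ vA] [/vA]] //.
  exact: leqW.
(* The new fire [b] may lie below layer [t]; adding [b.2] is harmless, since [A] need only contain
   the coordinates and may grow by one. *)
apply: (IH _ (b.2 |: A)) => // [|v|v].
- by rewrite cardsU1 -add1n leq_add // leq_b1.
- by case/setU1P=> [->//|/sB[]].
- case/setU1P=> [->|/sB[_ vA] [/vA Av]]; first by rewrite setU11.
  by rewrite in_setU1 Av orbT.
Qed.

End Product.

Theorem theorem26 (G H : sgraph) (k : nat) (k_gt0 : 0 < k) :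
  (k <= #|H| -> liminal_number (G □ H) k >= cooling_number G) /\
  (forall d : nat, 0 < #|G| -> diam G = Some d ->
     #|H| >= d + k -> liminal_number (G □ H) k >= d + 1).
Proof.
have cardGH : #|G □ H| = #|G| * #|H| := card_prod _ _.
split=> [kH|d G_gt0 diamG dkH].
  apply: cooling_le_burning; rewrite ?k_gt0 //; try by move=> v; rewrite inE.
  by rewrite cardGH leq_pmulr // (leq_trans k_gt0).
have [l [l_edge l_onto]] := diam_layers G_gt0 diamG.
rewrite addn1 -[d.+1]subn0.
apply: (@layers_le_burning _ _ k d l 0 _ set0) => //; try by move=> v; rewrite inE.
  (* The cutoff is large enough: [d.+1 <= d + k <= #|H|] because [0 < k]. *)
  rewrite cardGH subn0; apply: leq_trans (leq_pmull _ G_gt0).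
  by apply: leq_trans dkH; rewrite -addn1 leq_add2l.
by rewrite cards0.
Qed.
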